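(* Let $n\ge 2$, $\kappa>0$, $\omega^2\ge 0$ and $b_1,\dots,b_n\ge 0$ be real constants, and put $c=\kappa\omega^2$. On the phase space $\{(\mathbf q,\mathbf p)\in\mathbb R^n\times\mathbb R^n : q_j\ne 0 \text{ for all } j\}$ with its standard symplectic structure consider the Hamiltonian $$H(\mathbf p,\mathbf q)=\frac{\mathbf p^2-c+\sum_{j=1}^n b_j q_j^{-2}}{2(\kappa+\mathbf q^2)}.$$ For $1\le i\le n$ define $$I_i(\mathbf p,\mathbf q)=p_i^2-2H(\mathbf p,\mathbf q)\,q_i^2+b_i q_i^{-2}.$$ For $1<m\le n$ let $$C^{(m)}=\sum_{1\le i<j\le m}\Big[(q_ip_j-q_jp_i)^2+\frac{b_iq_j^2}{q_i^2}+\frac{b_jq_i^2}{q_j^2}\Big]+\sum_{i=1}^m b_i,$$ $$C_{(m)}=\sum_{n-m<i<j\le n}\Big[(q_ip_j-q_jp_i)^2+\frac{b_iq_j^2}{q_i^2}+\frac{b_jq_i^2}{q_j^2}\Big]+\sum_{i=n-m+1}^n b_i.$$ Then: (1) for every $1\le i\le n$, $I_i$ is a first integral of $H$, i.e. $\{I_i,H\}=0$, and the $2n-1$ first integrals of $H$ $$\{H\}\cup\{C^{(l)}:1<l<n\}\cup\{C_{(m)}:1<m\le n\}\cup\{I_i\}$$ are functionally independent; (2) the functions $I_1,\dots,I_n$ are in involution, i.e. $\{I_i,I_j\}=0$ for all $1\le i,j\le n$.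
   Context: Notation: $\mathbf u^2=\sum_{i=1}^n u_i^2$ for $\mathbf u\in\mathbb R^n$. The Poisson bracket is $\{f,g\}=\sum_{i=1}^n\left(\frac{\partial f}{\partial q_i}\frac{\partial g}{\partial p_i}-\frac{\partial f}{\partial p_i}\frac{\partial g}{\partial q_i}\right)$. A first integral of $H$ is a function $F$ with $\{F,H\}=0$. Smooth functions $F_1,\dots,F_k$ on the phase space are functionally independent if their differentials $dF_1,\dots,dF_k$ are linearly independent on an open dense subset. *)

(* Defs.v *)
From mathcomp Require Import all_boot all_order all_algebra.
From mathcomp Require Import all_classical all_reals all_analysis.

Set Implicit Arguments.
Unset Strict Implicit.
Unset Printing Implicit Defensive.

Import Order.TTheory GRing.Theory Num.Theory numFieldNormedType.Exports.
Local Open Scope classical_set_scope.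
Local Open Scope ring_scope.

(* A point of R^n x R^n is a pair (q, p); indices run over 0, ..., n-1. *)
Notation phase R n := ('rV[R]_n * 'rV[R]_n)%type (only parsing).

Definition qc (R : realType) (n : nat) (x : phase R n) (i : 'I_n) : R :=
  x.1 0 i.
Definition pc (R : realType) (n : nat) (x : phase R n) (i : 'I_n) : R :=
  x.2 0 i.

Definition phase_space (R : realType) (n : nat) : set (phase R n) :=
  [set x | forall j, qc x j != 0].

Definition dq (R : realType) (n : nat) (i : 'I_n)
    (f : phase R n -> R) (x : phase R n) : R :=
  'D_((delta_mx 0 i, 0) : phase R n) f x.
Definition dp (R : realType) (n : nat) (i : 'I_n)
    (f : phase R n -> R) (x : phase R n) : R :=
  'D_((0, delta_mx 0 i) : phase R n) f x.

Definition poisson (R : realType) (n : nat)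
    (f g : phase R n -> R) (x : phase R n) : R :=
  \sum_(i < n) (dq i f x * dp i g x - dp i f x * dq i g x).

Definition first_integral (R : realType) (n : nat)
    (H F : phase R n -> R) : Prop :=
  forall x, phase_space x -> poisson F H x = 0.

(* Class C^k on the open set D: since the space is finite-dimensional, x |-> 'd f x
   is C^k exactly when x |-> 'd f x v is C^k for every vector v. *)
Fixpoint continuously_diff (R : realType) (n : nat) (k : nat)
    (D : set (phase R n)) (f : phase R n -> R) : Prop :=
  match k with
  | 0 => forall x, D x -> {for x, continuous f}
  | k'.+1 => (forall x, D x -> differentiable f x) /\
             (forall v, continuously_diff k' D (fun x => 'd f x v))
  end.

Definition smooth (R : realType) (n : nat)
    (D : set (phase R n)) (f : phase R n -> R) : Prop :=
  forall k, continuously_diff k D f.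

Definition differential (R : realType) (n : nat)
    (f : phase R n -> R) (x : phase R n) : 'Hom(phase R n, R) :=
  linfun ('d f x).

(* The functions are indexed by their position in s, so that a repeated
   function makes the family dependent. *)
Definition functionally_independent (R : realType) (n : nat)
    (s : seq (phase R n -> R)) : Prop :=
  (forall F, F \in s -> smooth (@phase_space R n) F) /\
  exists U : set (phase R n),
    [/\ open U, U `<=` @phase_space R n, @phase_space R n `<=` closure U &
        forall x, U x -> free [seq differential F x | F <- s]].

Definition sqn (R : realType) (n : nat) (u : 'rV[R]_n) : R :=
  \sum_(i < n) u 0 i ^+ 2.

(* omega2 stands for omega^2, and kappa * omega2 is the constant c. *)
Definition ham (R : realType) (n : nat) (kappa omega2 : R) (b : 'I_n -> R)
    (x : phase R n) : R :=
  (sqn x.2 - kappa * omega2 + \sum_(j < n) b j * qc x j ^- 2)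
    / (2 * (kappa + sqn x.1)).

Definition Iint (R : realType) (n : nat) (kappa omega2 : R) (b : 'I_n -> R)
    (i : 'I_n) (x : phase R n) : R :=
  pc x i ^+ 2 - 2 * ham kappa omega2 b x * qc x i ^+ 2 + b i * qc x i ^- 2.

Definition Cterm (R : realType) (n : nat) (b : 'I_n -> R)
    (i j : 'I_n) (x : phase R n) : R :=
  (qc x i * pc x j - qc x j * pc x i) ^+ 2
    + b i * qc x j ^+ 2 / qc x i ^+ 2 + b j * qc x i ^+ 2 / qc x j ^+ 2.

Definition Cup (R : realType) (n : nat) (b : 'I_n -> R)
    (m : nat) (x : phase R n) : R :=
  \sum_(i < n) \sum_(j < n | (i < j < m)%N) Cterm b i j x
    + \sum_(i < n | (i < m)%N) b i.

(* With indices starting at 0, the last m of them are those with n - m <= i. *)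
Definition Cdown (R : realType) (n : nat) (b : 'I_n -> R)
    (m : nat) (x : phase R n) : R :=
  \sum_(i < n | (n - m <= i)%N) \sum_(j < n | (i < j)%N) Cterm b i j x
    + \sum_(i < n | (n - m <= i)%N) b i.

Definition integrals (R : realType) (n : nat) (kappa omega2 : R)
    (b : 'I_n -> R) (i : 'I_n) : seq (phase R n -> R) :=
  ham kappa omega2 b
    :: [seq Cup b l | l <- index_iota 2 n]
    ++ [seq Cdown b m | m <- index_iota 2 n.+1]
    ++ [:: Iint kappa omega2 b i].

(* Main.v *)
From HB Require Import structures.
Require Import Defs.
From mathcomp Require Import all_boot all_order all_algebra.
From mathcomp Require Import all_classical all_reals all_analysis.
From mathcomp Require Import ring lra zify.
Import Order.TTheory GRing.Theory Num.Theory numFieldNormedType.Exports.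
Local Open Scope classical_set_scope.
Local Open Scope ring_scope.

Set Implicit Arguments.
Unset Strict Implicit.
Unset Printing Implicit Defensive.

(* Put s_k = q_k^2, t_k = q_k p_k, e_k = p_k^2 + b_k / q_k^2 and
   x_k = (s_k, t_k, e_k).  With Q(s, t, e) = s e - t^2 one has Q(x_k) = b_k, and
   both kinds of C are the values of Q on partial sums of the x_k, while
   H = (e - c) / (2 (kappa + s)) at the total sum and I_i = e_i - 2 H s_i.
   Every Hamiltonian flow in play acts on each x_k through an element of sl_2:
   the same element for all k in the case of H, whence Q of partial sums is
   preserved, and an element annihilating e - 2 H s in the case of I_i.

   Independence.  In a linear relation between the differentials, the two
   sl_2-directions q d/dp and q d/dq - p d/dp annihilate all the dC, and dH and
   dI_i are independent on them at generic points.  What remains is a relation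
   between the dC; evaluated on variations of the k-th pair (q_k, p_k) it says
   that a combination Z_k of partial sums is Q-orthogonal to the tangent plane of
   {Q = b_k} at x_k, i.e. Z_k = lambda_k x_k.  Since Z_(k+1) - Z_k involves only
   sum_(i <= k) x_i and sum_(i > k) x_i, the linear independence of x_k,
   sum_(i < k) x_i and sum_(i > k) x_i kills all coefficients by induction on k.

   Density.  The genericity conditions are f <> 0 with f homogeneous in (p, b, c)
   for the weights (1, 2, 2), so sigma^d f(q, p + w / sigma) is a polynomial in
   sigma whose value at sigma = 0 is f at p = w, b = 0, c = 0.  That value is
   nonzero for w_k = k q_k (a Vandermonde sign argument), resp. for w the i-th
   basis vector, hence f(q, p + w / sigma) <> 0 for arbitrarily large sigma. *)

(** * Differential calculus and smoothness *)

Section Diff.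
Context {R : realType} {V : normedModType R}.
Implicit Types (x : V) (f g df dg : V -> R).

(** A differential depends only on the germ: the first-order expansion of f at x carries over to g,
    and expansions are unique. This is how [Cup] and [Cdown] get the differential of [cas], with
    which they are compared only where no q_k vanishes. *)
Lemma near_is_diff x f g df :
  (\near x, f x = g x) -> is_diff x f df -> is_diff x g df.
Proof.
move=> fg [dfx vdf].
have [cdf dfE] := (diff_locallyP x f).1 dfx.
have dgE : g \o shift x = cst (g x) + 'd f x +o_ 0 id.
  apply/eqaddoP => eps eps0.
  have := (eqaddoP _ _ _ _).1 dfE eps eps0.
  have fg0 : \forall h \near (0 : V), f (h + x) = g (h + x).
    have : (fun h : V => h + x) @ 0 --> x.
      by rewrite -[X in _ --> X]add0r; apply: cvgD; [exact: cvg_id|exact: cvg_cst].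
    by move=> /(_ _ fg).
  apply: filterS2 fg0 => h fgh.
  by rewrite /= !fctE /= fgh (nbhs_singleton fg).
have gfE := diff_unique cdf dgE.
split; last by rewrite gfE.
by apply/diff_locallyP; rewrite gfE.
Qed.

Lemma is_diff_fD x f g df dg : is_diff x f df -> is_diff x g dg ->
  is_diff x (fun y => f y + g y) (fun v => df v + dg v).
Proof. exact: is_diffD. Qed.

Lemma is_diff_fB x f g df dg : is_diff x f df -> is_diff x g dg ->
  is_diff x (fun y => f y - g y) (fun v => df v - dg v).
Proof. exact: is_diffB. Qed.

Lemma is_diff_fM x f g df dg : is_diff x f df -> is_diff x g dg ->
  is_diff x (fun y => f y * g y) (fun v => f x * dg v + g x * df v).
Proof. exact: is_diffM. Qed.

Lemma is_diff_fV x f df : is_diff x f df -> f x != 0 ->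
  is_diff x (fun y => (f y)^-1) (fun v => - (f x ^- 2 * df v)).
Proof.
move=> [dfx <-] fx0; split; first exact: differentiableV.
by rewrite diffV //; apply/funext => v; exact: mulNr.
Qed.

Lemma is_diff_fsum (I : Type) (r : seq I) (P : pred I) (f df : I -> V -> R) x :
  (forall i, P i -> is_diff x (f i) (df i)) ->
  is_diff x (fun y => \sum_(i <- r | P i) f i y)
            (fun v => \sum_(i <- r | P i) df i v).
Proof.
move=> fP; elim: r => [|i r IH].
  have -> : (fun y => \sum_(i <- [::] | P i) f i y) = cst 0.
    by apply/funext => y; rewrite big_nil.
  have -> : (fun y => \sum_(i <- [::] | P i) df i y) = 0.
    by apply/funext => y; rewrite big_nil.
  exact: is_diff_cst.
have -> : (fun y => \sum_(j <- i :: r | P j) f j y) =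
   (if P i then fun y => f i y + \sum_(j <- r | P j) f j y
    else fun y => \sum_(j <- r | P j) f j y).
  by case: ifP => Pi; apply/funext => y; rewrite big_cons Pi.
have -> : (fun y => \sum_(j <- i :: r | P j) df j y) =
   (if P i then fun y => df i y + \sum_(j <- r | P j) df j y
    else fun y => \sum_(j <- r | P j) df j y).
  by case: ifP => Pi; apply/funext => y; rewrite big_cons Pi.
by case: ifP => Pi //; apply: is_diff_fD => //; apply: fP.
Qed.

Lemma is_diff_fcst x (c : R) : is_diff x (fun=> c) (fun=> 0).
Proof. exact: is_diff_cst. Qed.

Lemma is_diff_fE x f df dg : is_diff x f df -> df =1 dg -> is_diff x f dg.
Proof. by move=> fdf /funext <-. Qed.

End Diff.

(** * Coordinate functions and openness of the phase space *)

Section Coordinates.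
Context {R : realType} {n : nat}.
Local Notation phase := (phase R n).

Lemma qc_linear (k : 'I_n) : linear (fun x : phase => qc x k).
Proof. by move=> a x y; rewrite /qc !mxE. Qed.

Lemma pc_linear (k : 'I_n) : linear (fun x : phase => pc x k).
Proof. by move=> a x y; rewrite /pc !mxE. Qed.

Lemma continuous_qc (k : 'I_n) : continuous (fun x : phase => qc x k).
Proof.
move=> x; apply: (@continuous_comp _ _ _ fst (fun u : 'rV[R]_n => u 0 k)).
  exact: cvg_fst.
exact: coord_continuous.
Qed.

Lemma continuous_pc (k : 'I_n) : continuous (fun x : phase => pc x k).
Proof.
move=> x; apply: (@continuous_comp _ _ _ snd (fun u : 'rV[R]_n => u 0 k)).
  exact: cvg_snd.
exact: coord_continuous.
Qed.

Lemma is_diff_qc (k : 'I_n) (x : phase) :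
  is_diff x (fun y => qc y k) (fun v => qc v k).
Proof.
pose aux := GRing.isLinear.Build _ _ _ _ _ (qc_linear k).
pose L : {linear phase -> R} := HB.pack (fun x : phase => qc x k) aux.
have cL : continuous L by exact: continuous_qc.
split; first exact: (linear_differentiable x cL).
exact: (diff_lin x cL).
Qed.

Lemma is_diff_pc (k : 'I_n) (x : phase) :
  is_diff x (fun y => pc y k) (fun v => pc v k).
Proof.
pose aux := GRing.isLinear.Build _ _ _ _ _ (pc_linear k).
pose L : {linear phase -> R} := HB.pack (fun x : phase => pc x k) aux.
have cL : continuous L by exact: continuous_pc.
split; first exact: (linear_differentiable x cL).
exact: (diff_lin x cL).
Qed.

Lemma open_phase_space : open (@phase_space R n).
Proof.
rewrite openE => x xD; rewrite /interior /=.
have := @filter_forall _ _ (fun k => [set y : phase | qc y k != 0]) (nbhs x) _.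
apply=> k.
have : open [set y : phase | qc y k != 0].
  apply: (@open_comp _ _ (fun y : phase => qc y k) [set c | c != 0]).
    by move=> y _; exact: continuous_qc.
  exact: open_neq.
by move=> oq; apply: open_nbhs_nbhs; split; [exact: oq|exact: xD].
Qed.

End Coordinates.

(** * Closure properties of smooth functions on an open set *)

Section Smooth.
Context {R : realType} {n : nat}.
Local Notation phase := (phase R n).
Variable D : set phase.
Hypothesis openD : open D.
Implicit Types (f g : phase -> R) (k : nat).

Lemma continuously_diffW k f : continuously_diff k.+1 D f ->
  continuously_diff k D f.
Proof.
elim: k f => [|k IH] f [df cdf].
  by move=> x Dx; apply: differentiable_continuous; exact: df.
by split=> // v; apply: IH.
Qed.

(** Since D is open, agreement on D is agreement near each of its points, so the differentials agree
    on D too and the induction goes on. This allows ['d f x v] to be replaced by an explicit formula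
    valid on D only. *)
Lemma eq_continuously_diff k f g : (forall x, D x -> f x = g x) ->
  continuously_diff k D f -> continuously_diff k D g.
Proof.
elim: k f g => [|k IH] f g fg.
  move=> cf x Dx; have fgx : \near x, f x = g x.
    by apply: filterS (open_nbhs_nbhs (conj openD Dx)).
  have cfx : f @ x --> g x by rewrite -(fg x Dx); exact: cf.
  by apply: cvg_trans cfx; apply: near_eq_cvg; apply: filterS fgx => y ->.
move=> [df cdf].
have isd x : D x -> is_diff x g ('d f x).
  move=> Dx; apply: (@near_is_diff _ _ _ f).
    by apply: filterS (open_nbhs_nbhs (conj openD Dx)).
  by split => //; exact: df.
split=> [x /isd[]//|v]; apply: IH (cdf v) => x /isd[_ ->]; by [].
Qed.

Lemma continuously_diff_cst k c : continuously_diff k D (fun=> c).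
Proof.
elim: k c => [|k IH] c; first by move=> x _; exact: cvg_cst.
split=> [x _|v]; first exact: differentiable_cst.
apply: (eq_continuously_diff _ (IH 0)) => x Dx.
by have [_ ->] := is_diff_fcst x c.
Qed.

Lemma continuously_diff_is_diff k f (df : phase -> phase -> R) :
  (forall x, D x -> is_diff x f (df x)) ->
  (forall v, continuously_diff k D (fun x => df x v)) ->
  continuously_diff k.+1 D f.
Proof.
move=> fdf cdf; split=> [x /fdf[]//|v].
by apply: (eq_continuously_diff _ (cdf v)) => x /fdf [_ ->].
Qed.

Lemma continuously_diffS k f : continuously_diff k.+1 D f ->
  (forall x, D x -> is_diff x f ('d f x)) /\
  (forall v, continuously_diff k D (fun x => 'd f x v)).
Proof. by move=> [df cdf]; split=> // x /df. Qed.

Lemma continuously_diffD k f g : continuously_diff k D f ->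
  continuously_diff k D g -> continuously_diff k D (fun x => f x + g x).
Proof.
elim: k f g => [|k IH] f g.
  by move=> cf cg x Dx; apply: cvgD; [exact: cf|exact: cg].
move=> /continuously_diffS[df cdf] /continuously_diffS[dg cdg].
apply: (continuously_diff_is_diff (df := fun x v => 'd f x v + 'd g x v)).
  by move=> x Dx; apply: is_diff_fD; [exact: df|exact: dg].
by move=> v; apply: IH.
Qed.

Lemma continuously_diffM k f g : continuously_diff k D f ->
  continuously_diff k D g -> continuously_diff k D (fun x => f x * g x).
Proof.
elim: k f g => [|k IH] f g.
  by move=> cf cg x Dx; apply: cvgM; [exact: cf|exact: cg].
move=> cf cg.
have [df cdf] := continuously_diffS cf; have [dg cdg] := continuously_diffS cg.
apply: (continuously_diff_is_diff
  (df := fun x v => f x * 'd g x v + g x * 'd f x v)).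
  by move=> x Dx; apply: is_diff_fM; [exact: df|exact: dg].
move=> v; apply: continuously_diffD; apply: IH => //; exact: continuously_diffW.
Qed.

Lemma continuously_diffV k f : (forall x, D x -> f x != 0) ->
  continuously_diff k D f -> continuously_diff k D (fun x => (f x)^-1).
Proof.
move=> f0; elim: k => [|k IH] cf.
  by move=> x Dx; apply: cvgV; [exact: f0|exact: cf].
have [df cdf] := continuously_diffS cf.
(* The derivative of 1/f is written as a product of 1/f, 1/f and ['d f x v], so that the induction
   hypothesis and closure under products suffice. *)
apply: (continuously_diff_is_diff
  (df := fun x v => -1 * ((f x)^-1 * (f x)^-1 * 'd f x v))).
  move=> x Dx; apply: is_diff_fE (is_diff_fV (df x Dx) (f0 x Dx)) _ => v.
  by rewrite mulN1r expr2 invfM.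
move=> v; do !apply: continuously_diffM => //; try exact: continuously_diff_cst.
  by apply: IH; exact: continuously_diffW.
by apply: IH; exact: continuously_diffW.
Qed.

Lemma smooth_cst c : smooth D (fun=> c).
Proof. by move=> k; exact: continuously_diff_cst. Qed.

Lemma smoothD f g : smooth D f -> smooth D g -> smooth D (fun x => f x + g x).
Proof. by move=> sf sg k; exact: continuously_diffD. Qed.

Lemma smoothM f g : smooth D f -> smooth D g -> smooth D (fun x => f x * g x).
Proof. by move=> sf sg k; exact: continuously_diffM. Qed.

Lemma smoothV f : (forall x, D x -> f x != 0) ->
  smooth D f -> smooth D (fun x => (f x)^-1).
Proof. by move=> f0 sf k; exact: continuously_diffV. Qed.

Lemma eq_smooth f g : (forall x, D x -> f x = g x) -> smooth D f -> smooth D g.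
Proof. by move=> fg sf k; exact: eq_continuously_diff fg (sf k). Qed.

Lemma smoothB f g : smooth D f -> smooth D g -> smooth D (fun x => f x - g x).
Proof.
move=> sf sg; apply: (@eq_smooth (fun x => f x + -1 * g x)).
  by move=> x _; rewrite mulN1r.
by apply: smoothD => //; apply: smoothM => //; exact: smooth_cst.
Qed.

Lemma smooth_exp f m : smooth D f -> smooth D (fun x => f x ^+ m).
Proof.
move=> sf; elim: m => [|m IH]; first exact: smooth_cst.
apply: (@eq_smooth (fun x => f x * f x ^+ m)); last exact: smoothM.
by move=> x _; rewrite exprS.
Qed.

Lemma smooth_sum (I : Type) (r : seq I) (P : pred I) (f : I -> phase -> R) :
  (forall i, P i -> smooth D (f i)) ->
  smooth D (fun x => \sum_(i <- r | P i) f i x).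
Proof.
move=> sf; elim: r => [|i r IH].
  by apply: eq_smooth (smooth_cst 0) => x _; rewrite big_nil.
case Pi: (P i); last by apply: eq_smooth IH => x _; rewrite big_cons Pi.
by apply: eq_smooth (smoothD (sf i Pi) IH) => x _; rewrite big_cons Pi.
Qed.

Lemma smooth_prod (I : Type) (r : seq I) (P : pred I) (f : I -> phase -> R) :
  (forall i, P i -> smooth D (f i)) ->
  smooth D (fun x => \prod_(i <- r | P i) f i x).
Proof.
move=> sf; elim: r => [|i r IH].
  by apply: eq_smooth (smooth_cst 1) => x _; rewrite big_nil.
case Pi: (P i); last by apply: eq_smooth IH => x _; rewrite big_cons Pi.
by apply: eq_smooth (smoothM (sf i Pi) IH) => x _; rewrite big_cons Pi.
Qed.

(** The derivative along v is the constant [f v], whence all orders. *)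
Lemma smooth_linear f : (forall x, is_diff x f f) -> smooth D f.
Proof.
move=> df [|k].
  by move=> x _; apply: differentiable_continuous; have [] := df x.
apply: (continuously_diff_is_diff (df := fun=> f)) => // v.
exact: continuously_diff_cst.
Qed.

Lemma smooth_qc (i : 'I_n) : smooth D (fun x => qc x i).
Proof. by apply: smooth_linear => x; exact: is_diff_qc. Qed.

Lemma smooth_pc (i : 'I_n) : smooth D (fun x => pc x i).
Proof. by apply: smooth_linear => x; exact: is_diff_pc. Qed.

End Smooth.

(** * The sl_2 structure and the Poisson brackets *)

Section Sl2.
Context {R : realType} {n : nat}.
Local Notation phase := (phase R n).
Variables (kappa omega2 : R) (b : 'I_n -> R).
Hypothesis kappa_gt0 : 0 < kappa.
Implicit Types (x v : phase) (k : 'I_n) (P : pred 'I_n).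

Definition xs k x : R := qc x k ^+ 2.
Definition xt k x : R := qc x k * pc x k.
Definition xe k x : R := pc x k ^+ 2 + b k / qc x k ^+ 2.

Definition Xs P x : R := \sum_(k | P k) xs k x.
Definition Xt P x : R := \sum_(k | P k) xt k x.
Definition Xe P x : R := \sum_(k | P k) xe k x.

Definition cas P x : R := Xs P x * Xe P x - Xt P x ^+ 2.

Definition dxs x k v : R := 2 * qc x k * qc v k.
Definition dxt x k v : R := qc x k * pc v k + pc x k * qc v k.
Definition dxe x k v : R := 2 * pc x k * pc v k - 2 * b k / qc x k ^+ 3 * qc v k.

Definition dcas x P v : R :=
  Xs P x * (\sum_(k | P k) dxe x k v) + Xe P x * (\sum_(k | P k) dxs x k v)
  - 2 * Xt P x * (\sum_(k | P k) dxt x k v).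

Local Notation H := (ham kappa omega2 b).
Local Notation I_ := (Iint kappa omega2 b).
Definition amp x : R := kappa + Xs predT x.

(** Quotient rule with the numerator of H eliminated in favour of H itself. *)
Definition dham x v : R :=
  ((\sum_k dxe x k v) / 2 - H x * (\sum_k dxs x k v)) / amp x.

Definition dIint x k v : R :=
  dxe x k v - 2 * H x * dxs x k v - 2 * xs k x * dham x v.

Lemma Xs_ge0 P x : 0 <= Xs P x.
Proof. by apply: sumr_ge0 => k _; exact: sqr_ge0. Qed.

Lemma amp_gt0 x : 0 < amp x.
Proof. by rewrite /amp ltr_wpDr ?Xs_ge0. Qed.

Lemma amp_neq0 x : amp x != 0.
Proof. exact: lt0r_neq0 (amp_gt0 x). Qed.

Lemma hamE x : H x = (Xe predT x - kappa * omega2) / (2 * amp x).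
Proof.
have -> : Xe predT x = sqn x.2 + \sum_(k < n) b k * qc x k ^- 2.
  by rewrite /Xe big_split.
by rewrite /ham addrAC.
Qed.

(** This is Q(x_k) = b_k. *)
Lemma xeK k x : qc x k != 0 -> xe k x * xs k x = xt k x ^+ 2 + b k.
Proof. by move=> q0; rewrite /xe /xs /xt; field. Qed.

(** Expansion of the quadratic form Q on a sum: the diagonal contributes Q(x_i) = b_i, and the
    polarisation of Q at x_i, x_j is [Cterm b i j], as in Lagrange's identity. *)
Lemma casE P x : phase_space x ->
  cas P x = \sum_(i | P i) \sum_(j | P j && (i < j)%N) Cterm b i j x
            + \sum_(i | P i) b i.
Proof.
move=> xD; rewrite /cas expr2 /Xs /Xe /Xt !big_distrl /= -sumrB.
pose F i j := xs i x * xe j x - xt i x * xt j x.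
transitivity (\sum_(i | P i) \sum_(j | P j) F i j).
  by apply: eq_bigr => i _; rewrite !big_distrr -sumrB.
transitivity (\sum_(i | P i) (b i + \sum_(j | P j && (i < j)%N) F i j
    + \sum_(j | P j && (j < i)%N) F i j)).
  apply: eq_bigr => i Pi; rewrite (bigID (fun j : 'I_n => (i < j)%N)) /=.
  rewrite (addrC (b i)) -addrA; congr (_ + _).
  rewrite (bigD1 i) /=; last by rewrite Pi ltnn.
  congr (_ + _); first by rewrite /F mulrC xeK ?xD //; ring.
  by apply: eq_bigl => j; rewrite -leqNgt ltn_neqAle andbAC -andbA.
rewrite !big_split /= -addrA addrC; congr (_ + _).
(* The pairs with j < i are relabelled, so that F i j and F j i meet in one sum over i < j. *)
rewrite [X in _ + X](exchange_big_dep P) /=; last by move=> i j _ /andP[].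
rewrite -big_split /=; apply: eq_bigr => i Pi.
rewrite [X in _ + X](eq_bigl (fun j : 'I_n => P j && (i < j)%N)); last first.
  by move=> j; rewrite Pi.
rewrite -big_split /=; apply: eq_bigr => j /andP[Pj ij].
have qi := xD i; have qj := xD j.
rewrite /F /Cterm /xs /xe /xt.
by field; apply/andP.
Qed.

Lemma CupE m x : phase_space x -> Cup b m x = cas (fun i => (i < m)%N) x.
Proof.
move=> xD; rewrite casE // /Cup; congr (_ + _).
rewrite [RHS]big_mkcond /=; apply: eq_bigr => i _.
case: ltnP => im.
  by apply: eq_bigl => j; rewrite andbC.
rewrite big_pred0 // => j; apply/negbTE/negP => /andP[ij /(ltn_trans ij)].
by rewrite ltnNge im.
Qed.

Lemma CdownE m x : phase_space x -> Cdown b m x = cas (fun i => (n - m <= i)%N) x.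
Proof.
move=> xD; rewrite casE // /Cdown; congr (_ + _).
apply: eq_bigr => i im; apply: eq_bigl => j.
by apply/esym/andb_idl => /ltnW; exact: leq_trans.
Qed.

Lemma is_diff_xs k x : is_diff x (xs k) (dxs x k).
Proof.
apply: is_diff_fE (is_diff_fM (is_diff_qc k x) (is_diff_qc k x)) _ => v.
by rewrite /dxs; ring.
Qed.

Lemma is_diff_xt k x : is_diff x (xt k) (dxt x k).
Proof. exact: is_diff_fM (is_diff_qc k x) (is_diff_pc k x). Qed.

Lemma is_diff_xe k x : qc x k != 0 -> is_diff x (xe k) (dxe x k).
Proof.
move=> q0; have q20 : xs k x != 0 by rewrite expf_neq0.
have dp2 := is_diff_fM (is_diff_pc k x) (is_diff_pc k x).
have dq2 := is_diff_fV (is_diff_xs k x) q20.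
apply: is_diff_fE (is_diff_fD dp2 (is_diff_fM (is_diff_fcst x (b k)) dq2)) _ => v.
by rewrite /dxe /dxs /xs; field.
Qed.

Lemma is_diff_Xs P x : is_diff x (Xs P) (fun v => \sum_(k | P k) dxs x k v).
Proof. by apply: is_diff_fsum => k _; exact: is_diff_xs. Qed.

Lemma is_diff_Xt P x : is_diff x (Xt P) (fun v => \sum_(k | P k) dxt x k v).
Proof. by apply: is_diff_fsum => k _; exact: is_diff_xt. Qed.

Lemma is_diff_Xe P x : phase_space x ->
  is_diff x (Xe P) (fun v => \sum_(k | P k) dxe x k v).
Proof. by move=> xD; apply: is_diff_fsum => k _; exact: is_diff_xe. Qed.

Lemma is_diff_cas P x : phase_space x -> is_diff x (cas P) (dcas x P).
Proof.
move=> xD; have dt := is_diff_Xt P x.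
apply: is_diff_fE (is_diff_fB (is_diff_fM (is_diff_Xs P x) (is_diff_Xe P xD))
  (is_diff_fM dt dt)) _ => v.
by rewrite /dcas; ring.
Qed.

Lemma is_diff_ham x : phase_space x -> is_diff x H (dham x).
Proof.
move=> xD.
have dA : is_diff x (fun y => 2 * amp y) _ := is_diff_fM (is_diff_fcst x 2)
  (is_diff_fD (is_diff_fcst x kappa) (is_diff_Xs predT x)).
have A0 : 2 * amp x != 0 by rewrite mulf_neq0 ?amp_neq0.
have dN := is_diff_fB (is_diff_Xe predT xD) (is_diff_fcst x (kappa * omega2)).
have -> : H = (fun y => (Xe predT y - kappa * omega2) * (2 * amp y)^-1).
  by apply/funext => y; rewrite hamE.
apply: is_diff_fE (is_diff_fM dN (is_diff_fV dA A0)) _ => v.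
rewrite /dham hamE -/(amp x).
by field; exact: amp_neq0.
Qed.

Lemma is_diff_Iint k x : phase_space x -> is_diff x (I_ k) (dIint x k).
Proof.
move=> xD.
have -> : I_ k = (fun y => xe k y - 2 * H y * xs k y).
  by apply/funext => y; rewrite /Iint /xe /xs; ring.
have d2H := is_diff_fM (is_diff_fcst x 2) (is_diff_ham xD).
apply: is_diff_fE (is_diff_fB (is_diff_xe (xD k))
  (is_diff_fM d2H (is_diff_xs k x))) _ => v.
by rewrite /dIint; ring.
Qed.

Lemma is_diff_Cup m x : phase_space x ->
  is_diff x (Cup b m) (dcas x (fun i => (i < m)%N)).
Proof.
move=> xD; apply: near_is_diff (is_diff_cas _ xD).
apply: filterS (open_nbhs_nbhs (conj open_phase_space xD)) => y yD.
by rewrite CupE.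
Qed.

Lemma is_diff_Cdown m x : phase_space x ->
  is_diff x (Cdown b m) (dcas x (fun i => (n - m <= i)%N)).
Proof.
move=> xD; apply: near_is_diff (is_diff_cas _ xD).
apply: filterS (open_nbhs_nbhs (conj open_phase_space xD)) => y yD.
by rewrite CdownE.
Qed.

(** * Smoothness of the integrals on the phase space *)

Local Notation PS := (@phase_space R n).

Lemma smooth_xs k : smooth PS (xs k).
Proof.
by have oD := @open_phase_space R n; apply: smooth_exp; [|exact: smooth_qc].
Qed.

Lemma smooth_xt k : smooth PS (xt k).
Proof.
have oD := @open_phase_space R n.
by apply: smoothM => //; [exact: smooth_qc|exact: smooth_pc].
Qed.

Lemma smooth_xe k : smooth PS (xe k).
Proof.
have oD := @open_phase_space R n.
apply: smoothD => //; first by apply: smooth_exp => //; exact: smooth_pc.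
apply: smoothM => //; first exact: smooth_cst.
apply: smoothV => //; last exact: smooth_xs.
by move=> x xD; rewrite expf_neq0 ?xD.
Qed.

Lemma smooth_Xs P : smooth PS (Xs P).
Proof.
by have oD := @open_phase_space R n; apply: smooth_sum => // k _; exact: smooth_xs.
Qed.

Lemma smooth_Xt P : smooth PS (Xt P).
Proof.
by have oD := @open_phase_space R n; apply: smooth_sum => // k _; exact: smooth_xt.
Qed.

Lemma smooth_Xe P : smooth PS (Xe P).
Proof.
by have oD := @open_phase_space R n; apply: smooth_sum => // k _; exact: smooth_xe.
Qed.

Lemma smooth_cas P : smooth PS (cas P).
Proof.
have oD := @open_phase_space R n; apply: smoothB => //.
  by apply: smoothM; [|exact: smooth_Xs|exact: smooth_Xe].
by apply: smooth_exp => //; exact: smooth_Xt.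
Qed.

Lemma smooth_ham : smooth PS H.
Proof.
have oD := @open_phase_space R n.
apply: (eq_smooth oD (fun x _ => esym (hamE x))).
apply: smoothM => //.
  by apply: smoothB => //; [exact: smooth_Xe|exact: smooth_cst].
apply: smoothV => //; first by move=> x _; rewrite mulf_neq0 ?amp_neq0.
apply: smoothM => //; first exact: smooth_cst.
by apply: smoothD => //; [exact: smooth_cst|exact: smooth_Xs].
Qed.

Lemma smooth_Iint k : smooth PS (I_ k).
Proof.
have oD := @open_phase_space R n.
apply: (@eq_smooth _ _ _ oD (fun y => xe k y - 2 * H y * xs k y)).
  by move=> x _; rewrite /Iint /xe /xs; ring.
apply: smoothB => //; first exact: smooth_xe.
apply: smoothM => //; last exact: smooth_xs.
by apply: smoothM => //; [exact: smooth_cst|exact: smooth_ham].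
Qed.

Lemma smooth_Cup m : smooth PS (Cup b m).
Proof.
apply: (eq_smooth (@open_phase_space R n)) (smooth_cas (fun i => (i < m)%N)).
by move=> x /CupE.
Qed.

Lemma smooth_Cdown m : smooth PS (Cdown b m).
Proof.
apply: (eq_smooth (@open_phase_space R n)) (smooth_cas (fun i => (n - m <= i)%N)).
by move=> x /CdownE.
Qed.

(** * Hamiltonian vector fields, sl_2 directions and Poisson brackets *)

Definition hamvec (G : phase -> R) x : phase :=
  (\row_k dp k G x, \row_k - dq k G x).

Lemma phase_decomp v :
  v = \sum_k (qc v k *: ((delta_mx 0 k, 0) : phase)
              + pc v k *: ((0, delta_mx 0 k) : phase)).
Proof.
case: v => q p; rewrite big_split /=.
have E1 (r : seq 'I_n) : \sum_(k <- r) qc (q, p) k *: ((delta_mx 0 k, 0) : phase)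
    = (\sum_(k <- r) q 0 k *: delta_mx 0 k, 0).
  elim: r => [|k r IH]; first by rewrite !big_nil.
  by rewrite !big_cons IH; congr (_, _); rewrite /= ?scaler0 ?addr0.
have E2 (r : seq 'I_n) : \sum_(k <- r) pc (q, p) k *: ((0, delta_mx 0 k) : phase)
    = (0, \sum_(k <- r) p 0 k *: delta_mx 0 k).
  elim: r => [|k r IH]; first by rewrite !big_nil.
  by rewrite !big_cons IH; congr (_, _); rewrite /= ?scaler0 ?addr0.
by rewrite E1 E2; congr (_, _); rewrite /= ?addr0 ?add0r -row_sum_delta.
Qed.

Lemma poissonE (F G : phase -> R) dF x : is_diff x F dF ->
  poisson F G x = dF (hamvec G x).
Proof.
move=> [dFx <-]; rewrite [in RHS](phase_decomp (hamvec G x)) linear_sum /=.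
apply: eq_bigr => k _; rewrite linearD !linearZ /= -!(deriveE _ dFx).
rewrite /qc /pc /hamvec /= !mxE.
congr (_ + _); first exact: mulrC.
exact: mulrC.
Qed.

(* The b_k-term makes x_k move by [[al, be], [ga, - al]] in sl_2, acting on binary
   quadratic forms: s' = 2 al s + 2 be t, t' = be e + ga s, e' = 2 ga t - 2 al e. *)
Definition sl2vec (al be ga : 'I_n -> R) x : phase :=
  (\row_k (al k * qc x k + be k * pc x k),
   \row_k (ga k * qc x k - al k * pc x k + be k * b k / qc x k ^+ 3)).

Lemma dxs_sl2vec al be ga x k :
  dxs x k (sl2vec al be ga x) = 2 * al k * xs k x + 2 * be k * xt k x.
Proof. by rewrite /dxs /sl2vec /xs /xt /qc /pc /= !mxE; ring. Qed.

Lemma dxt_sl2vec al be ga x k : phase_space x ->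
  dxt x k (sl2vec al be ga x) = be k * xe k x + ga k * xs k x.
Proof.
move=> /(_ k); rewrite /dxt /sl2vec /xs /xe /qc /pc /= !mxE => q0.
by field.
Qed.

Lemma dxe_sl2vec al be ga x k : phase_space x ->
  dxe x k (sl2vec al be ga x) = 2 * ga k * xt k x - 2 * al k * xe k x.
Proof.
move=> /(_ k); rewrite /dxe /sl2vec /xt /xe /qc /pc /= !mxE => q0.
by field.
Qed.

(** As the coefficients do not depend on k, the partial sums move by the same element of sl_2 as
    each x_k, and Q, the discriminant of a binary quadratic form, is invariant. *)
Lemma dcas_sl2vec (al be ga : R) P x : phase_space x ->
  dcas x P (sl2vec (fun=> al) (fun=> be) (fun=> ga) x) = 0.
Proof.
move=> xD; rewrite /dcas.
rewrite (eq_bigr _ (fun k _ => dxe_sl2vec _ _ _ k xD)).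
rewrite (eq_bigr _ (fun k _ => dxs_sl2vec _ _ _ x k)).
rewrite (eq_bigr _ (fun k _ => dxt_sl2vec _ _ _ k xD)).
rewrite sumrB !big_split /= -!big_distrr /= -/(Xs P x) -/(Xe P x) -/(Xt P x).
ring.
Qed.

(** Here e_k' = 4 H be_k t_k = 2 H s_k' for each k separately, so dH vanishes summand by summand
    even when be varies with k. *)
Lemma dham_sl2vec (be : 'I_n -> R) x : phase_space x ->
  dham x (sl2vec (fun=> 0) be (fun k => 2 * H x * be k) x) = 0.
Proof.
move=> xD; rewrite /dham big_distrl big_distrr -sumrB /= big1 ?mul0r // => k _.
by rewrite dxe_sl2vec // dxs_sl2vec; field.
Qed.

Lemma dIint_sl2vec (be : 'I_n -> R) x k : phase_space x ->
  dIint x k (sl2vec (fun=> 0) be (fun k => 2 * H x * be k) x) = 0.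
Proof.
by move=> xD; rewrite /dIint dham_sl2vec // dxe_sl2vec // dxs_sl2vec; ring.
Qed.

Definition q_dir k : phase := (delta_mx 0 k, 0).
Definition p_dir k : phase := (0, delta_mx 0 k).

Lemma sum_delta k (f : 'I_n -> R) : \sum_j f j * (j == k)%:R = f k.
Proof.
rewrite (bigD1 k) //= eqxx mulr1 big1 ?addr0 // => j /negbTE ->.
by rewrite mulr0.
Qed.

Lemma dxs_q x j k : dxs x j (q_dir k) = 2 * qc x j * (j == k)%:R.
Proof. by rewrite /dxs /q_dir /qc /= !mxE eqxx. Qed.

Lemma dxs_p x j k : dxs x j (p_dir k) = 0.
Proof. by rewrite /dxs /p_dir /qc /= !mxE mulr0. Qed.

Lemma dxe_q x j k : dxe x j (q_dir k) = - (2 * b j / qc x j ^+ 3) * (j == k)%:R.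
Proof. by rewrite /dxe /q_dir /qc /pc /= !mxE eqxx; ring. Qed.

Lemma dxe_p x j k : dxe x j (p_dir k) = 2 * pc x j * (j == k)%:R.
Proof. by rewrite /dxe /p_dir /qc /pc /= !mxE eqxx; ring. Qed.

Lemma dham_q x k :
  dham x (q_dir k) = - (b k / qc x k ^+ 3 + 2 * H x * qc x k) / amp x.
Proof.
rewrite /dham; under eq_bigr => j _ do rewrite dxe_q.
under [X in _ - _ * X]eq_bigr => j _ do rewrite dxs_q.
rewrite !sum_delta; congr (_ / _); set w := (qc x k ^+ 3)^-1.
by field.
Qed.

Lemma dham_p x k : dham x (p_dir k) = pc x k / amp x.
Proof.
rewrite /dham; under eq_bigr => j _ do rewrite dxe_p.
under [X in _ - _ * X]eq_bigr => j _ do rewrite dxs_p.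
by rewrite sum_delta big1_eq; congr (_ / _); field.
Qed.

Lemma hamvecE (G : phase -> R) dG x : is_diff x G dG ->
  hamvec G x = (\row_k dG (p_dir k), \row_k - dG (q_dir k)).
Proof.
by move=> [dGx <-]; congr (_, _); apply/rowP => k; rewrite !mxE /dp /dq deriveE.
Qed.

Lemma hamvec_ham x : phase_space x -> hamvec H x =
  sl2vec (fun=> 0) (fun=> (amp x)^-1) (fun=> 2 * H x * (amp x)^-1) x.
Proof.
move=> xD; rewrite (hamvecE (is_diff_ham xD)); congr (_, _); apply/rowP => k.
  by rewrite !mxE dham_p; ring.
by rewrite !mxE dham_q; ring.
Qed.

Lemma hamvec_Iint i x : phase_space x -> exists be, hamvec (I_ i) x =
  sl2vec (fun=> 0) be (fun k => 2 * H x * be k) x.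
Proof.
(* In dI_i = (de_i - 2 H ds_i) - 2 s_i dH, the bracket contributes only at k = i, while the last
   term contributes -2 s_i times the flow of H, whose coefficient is 1 / amp, at every k. *)
move=> xD; exists (fun k => 2 * (i == k)%:R - 2 * xs i x / amp x).
rewrite (hamvecE (is_diff_Iint i xD)); congr (_, _); apply/rowP => k; rewrite !mxE.
  rewrite /dIint dham_p dxe_p dxs_p.
  by case: eqVneq => [->|_] /=; ring.
rewrite /dIint dham_q dxe_q dxs_q.
by case: eqVneq => [->|_] /=; ring.
Qed.

Lemma poisson_Cup_ham m x : phase_space x -> poisson (Cup b m) H x = 0.
Proof.
by move=> xD; rewrite (poissonE _ (is_diff_Cup m xD)) hamvec_ham // dcas_sl2vec.
Qed.

Lemma poisson_Cdown_ham m x : phase_space x -> poisson (Cdown b m) H x = 0.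
Proof.
by move=> xD; rewrite (poissonE _ (is_diff_Cdown m xD)) hamvec_ham // dcas_sl2vec.
Qed.

Lemma poisson_ham_ham x : phase_space x -> poisson H H x = 0.
Proof.
move=> xD; rewrite (poissonE _ (is_diff_ham xD)) hamvec_ham //.
exact: (dham_sl2vec (fun=> _) xD).
Qed.

Lemma poisson_Iint_ham k x : phase_space x -> poisson (I_ k) H x = 0.
Proof.
move=> xD; rewrite (poissonE _ (is_diff_Iint k xD)) hamvec_ham //.
exact: (dIint_sl2vec (fun=> _) k xD).
Qed.

Lemma poisson_Iint i j x : phase_space x -> poisson (I_ i) (I_ j) x = 0.
Proof.
move=> xD; rewrite (poissonE _ (is_diff_Iint i xD)).
by have [be ->] := hamvec_Iint j xD; exact: dIint_sl2vec.
Qed.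

End Sl2.

(** * Linear algebra of the partial sums *)

(** Lets the coefficients of a linear relation be indexed by labels instead of positions in the
    sequence. *)
Lemma free_map (K : fieldType) (V : vectType K) (I : eqType) (r : seq I)
    (f : I -> V) : uniq r ->
  (forall c : I -> K, \sum_(i <- r) c i *: f i = 0 ->
     forall i, i \in r -> c i = 0) ->
  free [seq f i | i <- r].
Proof.
case: r => [|i0 r0]; first by rewrite /= nil_free.
set r := i0 :: r0 => ur fr.
change (free (in_tuple [seq f i | i <- r])); apply/freeP => k.
rewrite /= => kf0 j.
have szr : size [seq f i | i <- r] = size r by rewrite size_map.
(* Coefficients are carried from positions to labels; the default 0 is for labels outside [r]. *)
pose c i := if insub (index i r) is Some l then k l else 0.
have cE (l : 'I_(size [seq f i | i <- r])) : c (nth i0 r l) = k l.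
  by rewrite /c index_uniq -?szr //; case: insubP => [u _ /val_inj ->|];
    rewrite ?ltn_ord.
rewrite -(cE j); apply: fr; last by rewrite mem_nth // -szr.
rewrite (big_nth i0) big_mkord -szr -[RHS]kf0; apply: eq_bigr => l _.
rewrite cE; congr (_ *: _).
by rewrite -(nth_map i0 0 f (s := r)) // -szr.
Qed.

(** The 3x3 determinant with rows s, t, e and one column per vector, over a ring so that it applies
    to polynomials as well. *)
Definition det3 (A : comPzRingType) (s1 s2 s3 t1 t2 t3 e1 e2 e3 : A) : A :=
  s1 * (t2 * e3 - t3 * e2) - s2 * (t1 * e3 - t3 * e1)
  + s3 * (t1 * e2 - t2 * e1).

(** Cramer's rule: combining the three equations with the cofactors of a column yields the
    determinant times the corresponding coefficient. *)
Lemma det3_indep (R : fieldType) (s1 s2 s3 t1 t2 t3 e1 e2 e3 a b c : R) :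
  det3 s1 s2 s3 t1 t2 t3 e1 e2 e3 != 0 ->
  a * s1 + b * s2 + c * s3 = 0 -> a * t1 + b * t2 + c * t3 = 0 ->
  a * e1 + b * e2 + c * e3 = 0 -> [/\ a = 0, b = 0 & c = 0].
Proof.
move=> /mulIf d0 hs ht he; split; apply: d0; rewrite mul0r /det3.
- transitivity ((t2 * e3 - t3 * e2) * (a * s1 + b * s2 + c * s3)
    - (s2 * e3 - s3 * e2) * (a * t1 + b * t2 + c * t3)
    + (s2 * t3 - s3 * t2) * (a * e1 + b * e2 + c * e3)); first ring.
  by rewrite hs ht he; ring.
- transitivity (- (t1 * e3 - t3 * e1) * (a * s1 + b * s2 + c * s3)
    + (s1 * e3 - s3 * e1) * (a * t1 + b * t2 + c * t3)
    - (s1 * t3 - s3 * t1) * (a * e1 + b * e2 + c * e3)); first ring.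
  by rewrite hs ht he; ring.
- transitivity ((t1 * e2 - t2 * e1) * (a * s1 + b * s2 + c * s3)
    - (s1 * e2 - s2 * e1) * (a * t1 + b * t2 + c * t3)
    + (s1 * t2 - s2 * t1) * (a * e1 + b * e2 + c * e3)); first ring.
  by rewrite hs ht he; ring.
Qed.

Section Nondegenerate.
Context {n : nat}.

(* For the last index the sum over i > k is empty and the determinant vanishes:
   there, only x_k and sum_(i < k) x_i need to be independent. *)
Definition nondeg (A : comPzRingType) (s t e : 'I_n -> A) (k : 'I_n) : A :=
  if (k.+1 < n)%N then
    det3 (s k) (\sum_(i < n | (i < k)%N) s i) (\sum_(i < n | (k < i)%N) s i)
         (t k) (\sum_(i < n | (i < k)%N) t i) (\sum_(i < n | (k < i)%N) t i)
         (e k) (\sum_(i < n | (i < k)%N) e i) (\sum_(i < n | (k < i)%N) e i)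
  else s k * (\sum_(i < n | (i < k)%N) t i) - t k * (\sum_(i < n | (i < k)%N) s i).

(** Serves for evaluation of polynomials at sigma. *)
Lemma rmorph_nondeg (A B : comNzRingType) (f : {rmorphism A -> B})
    (s t e : 'I_n -> A) k :
  f (nondeg s t e k) = nondeg (f \o s) (f \o t) (f \o e) k.
Proof.
by rewrite /nondeg /det3; case: ifP => _;
  rewrite !(rmorphD, rmorphN, rmorphM, rmorph_sum).
Qed.

(** Homogeneity: the rescaling multiplies the determinant by a^3, and the 2x2 minor of the last
    index by a. *)
Lemma nondeg_scale (R : fieldType) (s t e : 'I_n -> R) (a : R) k : a != 0 ->
  (nondeg s (fun i => a * t i) (fun i => a ^+ 2 * e i) k == 0)
  = (nondeg s t e k == 0).
Proof.
move=> a0; rewrite /nondeg -!mulr_sumr; case: ifP => _.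
  rewrite -[RHS](mulrI_eq0 _ (mulfI (expf_neq0 3 a0))); congr (_ == 0).
  by rewrite /det3; ring.
rewrite -[RHS](mulrI_eq0 _ (mulfI a0)); congr (_ == 0).
by ring.
Qed.

(** The vectors are s_i (1, i, i^2). Recentring at k turns the k-th one into s_k (1, 0, 0) and
    leaves a minor in the centred moments A1, A2 of the indices below k and B1, B2 of those above.
    Its two products have the same sign, and A1 > 0 because index 0 lies below k. *)
Lemma nondeg_moment (R : realFieldType) (s : 'I_n -> R) (k : 'I_n) :
  (forall i, 0 < s i) -> (0 < k)%N ->
  nondeg s (fun i => i%:R * s i) (fun i => i%:R ^+ 2 * s i) k != 0.
Proof.
move=> s0 k0.
pose A1 := \sum_(i < n | (i < k)%N) (k%:R - i%:R) * s i.
pose A2 := \sum_(i < n | (i < k)%N) (k%:R - i%:R) ^+ 2 * s i.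
have A1E : A1 = k%:R * (\sum_(i < n | (i < k)%N) s i)
    - \sum_(i < n | (i < k)%N) i%:R * s i.
  by rewrite mulr_sumr -sumrB; apply: eq_bigr => i _; rewrite mulrBl.
have A2E : A2 = k%:R ^+ 2 * (\sum_(i < n | (i < k)%N) s i)
    - 2 * k%:R * (\sum_(i < n | (i < k)%N) i%:R * s i)
    + \sum_(i < n | (i < k)%N) i%:R ^+ 2 * s i.
  by rewrite !mulr_sumr -sumrB -big_split; apply: eq_bigr => i _ /=; ring.
have n0 : (0 < n)%N by apply: leq_ltn_trans (ltn_ord k).
have A1_gt0 : 0 < A1.
  rewrite /A1 (bigD1 (Ordinal n0)) //= ltr_wpDr //.
    apply: sumr_ge0 => i /andP[ik _]; rewrite mulr_ge0 ?(ltW (s0 _)) //.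
    by rewrite subr_ge0 ler_nat ltnW.
  by rewrite mulr_gt0 // subr_gt0 ltr_nat.
rewrite /nondeg; case: ifP => kn; last first.
  rewrite -mulrA [X in _ - X]mulrCA -mulrBr mulf_neq0 ?(lt0r_neq0 (s0 _)) //.
  by rewrite -opprB -A1E oppr_eq0 lt0r_neq0.
pose B1 := \sum_(i < n | (k < i)%N) (i%:R - k%:R) * s i.
pose B2 := \sum_(i < n | (k < i)%N) (i%:R - k%:R) ^+ 2 * s i.
have B1E : B1 = (\sum_(i < n | (k < i)%N) i%:R * s i)
    - k%:R * \sum_(i < n | (k < i)%N) s i.
  by rewrite mulr_sumr -sumrB; apply: eq_bigr => i _; rewrite mulrBl.
have B2E : B2 = k%:R ^+ 2 * (\sum_(i < n | (k < i)%N) s i)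
    - 2 * k%:R * (\sum_(i < n | (k < i)%N) i%:R * s i)
    + \sum_(i < n | (k < i)%N) i%:R ^+ 2 * s i.
  by rewrite !mulr_sumr -sumrB -big_split; apply: eq_bigr => i _ /=; ring.
have A2_ge0 : 0 <= A2.
  by apply: sumr_ge0 => i _; rewrite mulr_ge0 ?sqr_ge0 ?(ltW (s0 _)).
have B1_ge0 : 0 <= B1.
  apply: sumr_ge0 => i ki; rewrite mulr_ge0 ?(ltW (s0 _)) //.
  by rewrite subr_ge0 ler_nat ltnW.
have B2_gt0 : 0 < B2.
  rewrite /B2 (bigD1 (Ordinal kn)) //= ltr_wpDr //.
    by apply: sumr_ge0 => i _; rewrite mulr_ge0 ?sqr_ge0 ?(ltW (s0 _)).
  by rewrite mulr_gt0 // exprn_gt0 // subr_gt0 ltr_nat.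
rewrite (_ : det3 _ _ _ _ _ _ _ _ _ = - (s k * (A1 * B2 + B1 * A2))).
  rewrite oppr_eq0 mulf_neq0 ?lt0r_neq0 //.
  by rewrite ltr_wpDr ?mulr_ge0 ?mulr_gt0.
by rewrite A1E A2E B1E B2E /det3; ring.
Qed.

End Nondegenerate.

(** * Vanishing of the coefficients in a relation between the dC *)

Section CasimirIndependence.
Context {R : realFieldType} {n : nat}.
Variables (s t e : 'I_n -> R) (beta gamma : nat -> R).
Hypotheses (n_gt1 : (1 < n)%N) (s_gt0 : forall i, 0 < s i).
Hypothesis st_nondeg : forall k : 'I_n, (0 < k)%N -> nondeg s t e k != 0.

(* If sum beta_l dC^(l) + sum gamma_m dC_(m) = 0, these are the coordinates (for
   f = s, t, e) of the vector that is Q-orthogonal to the k-th tangent plane. *)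
Definition Zsum (f : 'I_n -> R) (k : nat) : R :=
  \sum_(l <- index_iota 2 n) beta l * ((k < l)%N%:R * \sum_(i < n | (i < l)%N) f i)
  + \sum_(m <- index_iota 2 n.+1)
      gamma m * ((n - m <= k)%N%:R * \sum_(i < n | (n - m <= i)%N) f i).

(** [beta0] and [gamma0] extend the coefficients by 0 outside the ranges of l and m; [gamma0] is
    indexed by n - m, so that both refer to the index at which [Zsum] jumps. *)
Definition beta0 k := if (1 < k < n)%N then beta k else 0.
Definition gamma0 k := if (1 < n - k)%N then gamma (n - k)%N else 0.

Lemma sum_index_delta (a c j : nat) (f : nat -> R) :
  \sum_(l <- index_iota a c) (l == j)%:R * f l
  = if (a <= j < c)%N then f j else 0.
Proof.
case: ifP => jac.
  rewrite (bigD1_seq j) ?mem_index_iota ?iota_uniq //= eqxx mul1r.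
  by rewrite big1 ?addr0 // => l /negbTE ->; rewrite mul0r.
rewrite big_seq big1 // => l; rewrite mem_index_iota.
by case: eqP => [->|_ _]; rewrite ?jac ?mul0r.
Qed.

(** From k to k + 1 only two terms change: C^(l) with l = k + 1 no longer contains the index, and
    C_(m) with n - m = k + 1 starts to contain it. *)
Lemma ZsumS f k : (k.+1 < n)%N ->
  Zsum f k.+1 = Zsum f k - beta0 k.+1 * \sum_(i < n | (i < k.+1)%N) f i
                + gamma0 k.+1 * \sum_(i < n | (k < i)%N) f i.
Proof.
move=> kn; pose u l := beta l * \sum_(i < n | (i < l)%N) f i.
pose w m := gamma m * \sum_(i < n | (n - m <= i)%N) f i.
have -> : beta0 k.+1 * (\sum_(i < n | (i < k.+1)%N) f i) =
    \sum_(l <- index_iota 2 n) (l == k.+1)%:R * u l.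
  by rewrite sum_index_delta /beta0; case: ifP => // _; rewrite mul0r.
have -> : gamma0 k.+1 * (\sum_(i < n | (k < i)%N) f i) =
    \sum_(m <- index_iota 2 n.+1) (m == (n - k.+1)%N)%:R * w m.
  rewrite sum_index_delta /gamma0 /w ltnS leq_subr andbT.
  by rewrite (subKn (ltnW kn)); case: ifP => _; rewrite ?mul0r.

have acomp (p q r v : R) : p + q - r + v = (p - r) + (q + v) by ring.
rewrite /Zsum acomp -sumrB -big_split; congr (_ + _).
  apply: eq_bigr => l _; rewrite /u.
  have -> : (k < l)%N%:R = (k.+1 < l)%N%:R + (l == k.+1)%:R :> R.
    by rewrite -natrD; congr (_%:R); lia.
  ring.
rewrite big_seq [RHS]big_seq; apply: eq_bigr => m.
rewrite mem_index_iota => /andP[_ mn]; rewrite /w /=.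
have -> : (n - m <= k.+1)%N%:R = (n - m <= k)%N%:R + (m == (n - k.+1)%N)%:R :> R.
  by rewrite -natrD; congr (_%:R); lia.
ring.
Qed.

Hypothesis Zst : forall k : 'I_n, Zsum s k * t k = Zsum t k * s k.
Hypothesis Zse : forall k : 'I_n, Zsum s k * e k = Zsum e k * s k.

Let lam (k : 'I_n) := Zsum s k / s k.

Lemma Zs_lam (k : 'I_n) : Zsum s k = lam k * s k.
Proof. by rewrite /lam divfK ?lt0r_neq0. Qed.

Lemma Zt_lam (k : 'I_n) : Zsum t k = lam k * t k.
Proof. by rewrite /lam mulrAC Zst mulfK ?lt0r_neq0. Qed.

Lemma Ze_lam (k : 'I_n) : Zsum e k = lam k * e k.
Proof. by rewrite /lam mulrAC Zse mulfK ?lt0r_neq0. Qed.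

Lemma sum_lt1 (f : 'I_n -> R) (k : 'I_n) : nat_of_ord k = 0%N ->
  \sum_(i < n | (i < 1)%N) f i = f k.
Proof.
move=> k0; rewrite (big_pred1 k) // => i.
by rewrite /= -val_eqE /= k0 ltnS leqn0.
Qed.

(** [ZsumS] read as a linear relation between x_k and the sums below and above k. The term lam_j x_j
    vanishes by induction for j > 0; for j = 0 the sum below k is x_0 itself and absorbs it. *)
Lemma Zstep (f : 'I_n -> R) (j k : 'I_n) : nat_of_ord k = j.+1 ->
    (forall i : 'I_n, Zsum f i = lam i * f i) -> ((0 < j)%N -> lam j = 0) ->
  (lam k - gamma0 k) * f k
  + (beta0 k - (j == 0%N :> nat)%:R * lam j) * (\sum_(i < n | (i < k)%N) f i)
  + - gamma0 k * (\sum_(i < n | (k < i)%N) f i) = 0.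
Proof.
move=> kj Zlam lamj.
have := ZsumS f (k := j); rewrite -kj ltn_ord => /(_ isT).
rewrite !Zlam.
have -> : \sum_(i < n | (k <= i)%N) f i = f k + \sum_(i < n | (k < i)%N) f i.
  rewrite (bigD1 k) //=; congr (_ + _); apply: eq_bigl => i.
  by rewrite ltn_neqAle eq_sym andbC.
have [j0|j0] := posnP j.
  have -> : \sum_(i < n | (i < k)%N) f i = f j by rewrite kj j0 (sum_lt1 _ j0).
  by move=> E; rewrite mulrBl E /=; ring.
by rewrite (lamj j0) => E; rewrite mulrBl E /=; ring.
Qed.

Lemma nondeg_coef0 (j k : 'I_n) : nat_of_ord k = j.+1 ->
  ((0 < j)%N -> lam j = 0) ->
  [/\ lam k = 0, gamma0 k = 0 & beta0 k = (j == 0%N :> nat)%:R * lam j].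
Proof.
move=> kj lamj; have k0 : (0 < k)%N by rewrite kj.
have hs := Zstep kj Zs_lam lamj; have ht := Zstep kj Zt_lam lamj.
have he := Zstep kj Ze_lam lamj.
have := st_nondeg k0; rewrite /nondeg; case: ifP => kn.
  move=> /det3_indep /(_ hs ht he)[/eqP + /eqP + /eqP].
  by rewrite !subr_eq0 oppr_eq0 => /eqP -> /eqP -> /eqP ->.
(* Here k is the last index, so n - k = 1 falls outside the range of m. *)
have g0 : gamma0 k = 0.
  by rewrite /gamma0; case: ifP => //; have := ltn_ord k; lia.
move=> /mulIf d0; move: hs ht; rewrite g0 subr0 oppr0 !mul0r !addr0 => hs ht.
set mu := beta0 k - _ in hs ht.
have mu0 : mu = 0.
  apply: d0; rewrite mul0r.
  set S := \sum_(i < n | _) s i in hs ht *; set T := \sum_(i < n | _) t i in hs ht *.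
  transitivity (s k * (lam k * t k + mu * T) - t k * (lam k * s k + mu * S)).
    ring.
  by rewrite hs ht !mulr0 subr0.
move: hs; rewrite mu0 mul0r addr0 => /eqP; rewrite mulf_eq0 (gt_eqF (s_gt0 k)) orbF.
by move=> /eqP ->; split => //; apply/eqP; rewrite -subr_eq0 -/mu mu0.
Qed.

Lemma lam_eq0 (k : 'I_n) : (0 < k)%N -> lam k = 0.
Proof.
case: k => k; elim: k => // -[|k] IH kn _.
  by have [] := @nondeg_coef0 (Ordinal (ltnW n_gt1)) (Ordinal kn) erefl.
by have [] := @nondeg_coef0 (Ordinal (ltnW kn)) (Ordinal kn) erefl (fun=> IH _ isT).
Qed.

Lemma casimir_coef0 :
  (forall l, (1 < l < n)%N -> beta l = 0) /\
  (forall m, (1 < m <= n)%N -> gamma m = 0).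
Proof.
have step k (kn : (k.+1 < n)%N) :=
  @nondeg_coef0 (Ordinal (ltnW kn)) (Ordinal kn) erefl (@lam_eq0 _).
(* The step from 0 to 1 gives lam_0 = [beta0 1], and l = 1 is outside the range of l. *)
have lam0 : lam (Ordinal (ltnW n_gt1)) = 0.
  by have [_ _] := step 0%N n_gt1; rewrite /beta0 /= mul1r => <-.
have beta_eq0 l : (1 < l < n)%N -> beta l = 0.
  case: l => // -[//|l] ln; have ln' : (l.+2 < n)%N by case/andP: ln.
  by have [_ _] := step _ ln'; rewrite /beta0 /= ln' /= mul0r.
split=> // m /andP[m1]; rewrite leq_eqVlt => /orP[/eqP ->|mn]; last first.
  have kn : ((n - m).-1.+1 < n)%N by lia.
  have [_ + _] := step _ kn; rewrite /gamma0 /=.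
  have -> : (n - (n - m).-1.+1 = m)%N by lia.
  by rewrite m1.
(* C_(n) contains every index and causes no jump, so its coefficient is read off Z_0 = 0: there only
   m = n is left, multiplied by the positive total of the s_i. *)
have := Zs_lam (Ordinal (ltnW n_gt1)); rewrite lam0 mul0r /Zsum /=.
rewrite big_seq big1 ?add0r; last first.
  by move=> l; rewrite mem_index_iota => /beta_eq0 ->; rewrite mul0r.
under eq_bigr => i _ do rewrite leqn0 subn_eq0.
rewrite big_nat_recr //= leqnn mul1r subnn.
rewrite big_nat big1 ?add0r; last first.
  by move=> i /andP[_ ni]; rewrite leqNgt ni mul0r mulr0.
move/eqP; rewrite mulf_eq0 => /orP[/eqP //|].
rewrite gt_eqF // (bigD1 (Ordinal (ltnW n_gt1))) //= ltr_wpDr //.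
by apply: sumr_ge0 => i _; exact: ltW.
Qed.

End CasimirIndependence.

(** The points N + 1, ..., N + [size p] are too many to be all roots. *)
Lemma exists_nonroot (R : realFieldType) (p : {poly R}) (N : R) : p != 0 ->
  exists2 x, N < x & p.[x] != 0.
Proof.
move=> p0; pose r := [seq N + i.+1%:R | i <- iota 0 (size p)].
have : ~~ all (root p) r.
  apply/negP => /(max_poly_roots p0).
  rewrite size_map size_iota ltnn; move/implyP; rewrite implybF => /negP; apply.
  rewrite map_inj_uniq ?iota_uniq // => i j /addrI /eqP.
  by rewrite eqr_nat eqSS => /eqP.
move=> /allPn[x /mapP[i _ ->] px]; exists (N + i.+1%:R) => //.
by rewrite ltrDl.
Qed.

(** * Density of the regular points *)

Section Density.
Context {R : realType} {n : nat}.
Local Notation phase := (phase R n).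
Variables (kappa omega2 : R) (b : 'I_n -> R).
Hypothesis kappa_gt0 : 0 < kappa.
Local Notation H := (ham kappa omega2 b).
Local Notation PS := (@phase_space R n).
Implicit Types (x : phase) (w : 'rV[R]_n).

Definition p_shift x w (sigma : R) : phase := x + sigma^-1 *: ((0, w) : phase).

Lemma p_shift_near x w (O : set phase) : nbhs x O ->
  exists N : R, forall sigma, N < sigma -> O (p_shift x w sigma).
Proof.
move=> xO.
have : (fun tau : R => x + tau *: ((0, w) : phase)) @ 0 -->
    x + 0 *: ((0, w) : phase).
  by apply: cvgD; [exact: cvg_cst|apply: cvgZ; [exact: cvg_id|exact: cvg_cst]].
rewrite scale0r addr0 => /(_ _ xO) /nbhs_ballP[eps /= eps0 epsO].
exists eps^-1 => sigma seps; apply: (epsO (sigma^-1)).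
have s0 : 0 < sigma by apply: lt_trans seps; rewrite invr_gt0.
by rewrite /ball /= sub0r normrN gtr0_norm ?invr_gt0 // invf_plt ?posrE.
Qed.

(** G plays the part of a power of sigma times f along the shifted points. [G.[0] != 0] shows that G
    is not the zero polynomial; its nonroots, taken large, give points close to x. Only momenta are
    shifted, so these stay in the phase space. *)
Lemma near_nonzero (f : phase -> R) x w (G : {poly R}) (O : set phase) :
  (forall sigma, sigma != 0 -> f (p_shift x w sigma) = 0 -> G.[sigma] = 0) ->
  G.[0] != 0 -> PS x -> nbhs x O -> exists y, [/\ O y, PS y & f y != 0].
Proof.
move=> fG G0 xD /(p_shift_near w) [N NO].
have Gn0 : G != 0 by apply: contraNneq G0 => ->; rewrite horner0.
have [sigma Nsigma Gs] := exists_nonroot (Num.max N 0) Gn0.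
move: Nsigma; rewrite gt_max => /andP[Ns s0].
exists (p_shift x w sigma); split; first exact: NO.
  by move=> k; rewrite /p_shift /qc /= !mxE mulr0 addr0; exact: xD.
by apply: contraNneq Gs => /fG ->; rewrite ?lt0r_neq0.
Qed.

(* The coordinates of p_shift x w sigma, rescaled by 1, sigma, sigma^2. *)
Definition polys x k : {poly R} := (xs k x)%:P.
Definition polyt x w k : {poly R} := (xt k x)%:P * 'X + (qc x k * w 0 k)%:P.
Definition polye x w k : {poly R} :=
  ((pc x k)%:P * 'X + (w 0 k)%:P) ^+ 2 + (b k / qc x k ^+ 2)%:P * 'X ^+ 2.

Lemma polys_shift x w sigma k : sigma != 0 ->
  xs k (p_shift x w sigma) = (polys x k).[sigma].
Proof.
by move=> s0; rewrite /polys hornerE /xs /p_shift /qc /= !mxE mulr0 addr0.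
Qed.

Lemma polyt_shift x w sigma k : sigma != 0 ->
  xt k (p_shift x w sigma) = sigma^-1 * (polyt x w k).[sigma].
Proof.
move=> s0; rewrite /polyt !hornerE /xt /p_shift /qc /pc /= !mxE.
by field.
Qed.

Lemma polye_shift x w sigma k : sigma != 0 ->
  xe b k (p_shift x w sigma) = sigma^-1 ^+ 2 * (polye x w k).[sigma].
Proof.
move=> s0; rewrite /polye !hornerE /xe /p_shift /qc /pc /= !mxE mulr0 addr0.
set c := b k / _.
by field.
Qed.

Lemma polys0 x k : (polys x k).[0] = xs k x.
Proof. by rewrite /polys hornerE. Qed.

Lemma polyt0 x w k : (polyt x w k).[0] = qc x k * w 0 k.
Proof. by rewrite /polyt !hornerE. Qed.

Lemma polye0 x w k : (polye x w k).[0] = w 0 k ^+ 2.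
Proof. by rewrite /polye !(hornerD, hornerM, horner_exp, hornerC, hornerX); ring. Qed.

(** The factor k = 0 is left out: the sum below it is empty, so [nondeg] vanishes there. *)
Definition casimir_nondeg x : R :=
  \prod_(k < n | (0 < k)%N) nondeg (xs^~ x) (xt^~ x) (xe b ^~ x) k.

Lemma casimir_nondeg_dense x (O : set phase) : PS x -> nbhs x O ->
  exists y, [/\ O y, PS y & casimir_nondeg y != 0].
Proof.
(* At sigma = 0 this turns (s_k, t_k, e_k) into q_k^2 (1, k, k^2), the configuration of
   [nondeg_moment]. *)
move=> xD; pose w : 'rV[R]_n := \row_k (k%:R * qc x k).
pose G : {poly R} :=
  \prod_(k < n | (0 < k)%N) nondeg (polys x) (polyt x w) (polye x w) k.
have GE (sigma : R) : G.[sigma] = \prod_(k < n | (0 < k)%N)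
   nondeg (fun k => (polys x k).[sigma]) (fun k => (polyt x w k).[sigma])
     (fun k => (polye x w k).[sigma]) k.
  rewrite /G horner_prod; apply: eq_bigr => k _.
  exact: (rmorph_nondeg (horner_eval sigma)).
apply: (near_nonzero (w := w) (G := G)) => //.
  move=> sigma s0 /eqP /prodf_eq0 [k k0 ndk]; apply/eqP; rewrite GE.
  apply/prodf_eq0; exists k => //.
  rewrite -(nondeg_scale _ _ _ k (invr_neq0 s0)).
  rewrite (_ : nondeg _ _ _ _ = nondeg (xs^~ (p_shift x w sigma))
    (xt^~ (p_shift x w sigma)) (xe b ^~ (p_shift x w sigma)) k) //.
  congr nondeg; apply/funext => i; apply/esym.
  - exact: polys_shift.
  - exact: polyt_shift.
  - exact: polye_shift.
rewrite GE; apply/prodf_neq0 => k k0.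
have := nondeg_moment (s := xs^~ x) (k := k) _ k0.
rewrite (_ : (fun k => (polys x k).[0]) = xs^~ x); last first.
  by apply/funext => i; rewrite polys0.
rewrite (_ : (fun k => (polyt x w k).[0]) = fun i => i%:R * xs i x); last first.
  by apply/funext => i; rewrite polyt0 mxE /xs; ring.
rewrite (_ : (fun k => (polye x w k).[0]) = fun i => i%:R ^+ 2 * xs i x); last first.
  by apply/funext => i; rewrite polye0 mxE /xs; ring.
by apply=> i; rewrite exprn_even_gt0 //= xD.
Qed.

(* Up to a nonzero factor, the determinant of (dH, dI_i) on the vectors
   q d/dp and q d/dq - p d/dp. *)
Definition hamI_nondeg (i : 'I_n) x : R :=
  let A := amp kappa x in let N := Xe b predT x - kappa * omega2 in
  xt i x * (A * Xe b predT x + N * Xs predT x)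
  - Xt predT x * (A * xe b i x + N * xs i x).

Lemma hamI_nondeg_dense (i : 'I_n) x (O : set phase) :
  (1 < n)%N -> PS x -> nbhs x O ->
  exists y, [/\ O y, PS y & hamI_nondeg i y != 0].
Proof.
move=> n1 xD; pose w : 'rV[R]_n := delta_mx 0 i.
pose A := (amp kappa x)%:P.
pose Pe : {poly R} := \sum_k polye x w k.
pose Pt : {poly R} := \sum_k polyt x w k.
pose Ps : {poly R} := \sum_k polys x k.
(* The constant c has weight 2 like e, hence the factor ['X ^+ 2]; [G] has total weight 3. *)
pose N : {poly R} := Pe - (kappa * omega2)%:P * 'X ^+ 2.
pose G : {poly R} := polyt x w i * (A * Pe + N * Ps)
  - Pt * (A * polye x w i + N * polys x i).
apply: (near_nonzero (w := w) (G := G)) => //.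
  move=> sigma s0; rewrite /hamI_nondeg /amp.
  have -> : Xe b predT (p_shift x w sigma) = sigma^-1 ^+ 2 * Pe.[sigma].
    rewrite /Xe /Pe horner_sum mulr_sumr; apply: eq_bigr => k _.
    exact: polye_shift.
  have -> : Xt predT (p_shift x w sigma) = sigma^-1 * Pt.[sigma].
    rewrite /Xt /Pt horner_sum mulr_sumr; apply: eq_bigr => k _.
    exact: polyt_shift.
  have XsE : Xs predT (p_shift x w sigma) = Xs predT x.
    by apply: eq_bigr => k _; rewrite polys_shift // /polys hornerE.
  have PsE : Ps.[sigma] = Xs predT x.
    by rewrite /Ps horner_sum; apply: eq_bigr => k _; rewrite /polys hornerE.
  rewrite XsE polyt_shift // polye_shift // polys_shift // => f0.
  transitivity (sigma ^+ 3 * 0); last by rewrite mulr0.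
  rewrite -f0 /G /N /A; clear f0 G N A.
  move: (polyt x w i) (polye x w i) (polys x i) Pe Pt Ps PsE => u v r Qe Qt Qs QsE.
  rewrite !(hornerD, hornerN, hornerM, hornerC, hornerX) QsE /amp.
  by field.
have qi : qc x i != 0 := xD i.
have wE k : w 0 k = (k == i)%:R by rewrite mxE eqxx.
have Pe0 : Pe.[0] = 1.
  rewrite /Pe horner_sum -(sum_delta i (fun=> 1)); apply: eq_bigr => k _.
  by rewrite polye0 wE; case: eqP => _ /=; rewrite ?expr1n ?expr0n ?mulr0 ?mulr1.
have Pt0 : Pt.[0] = qc x i.
  rewrite /Pt horner_sum -(sum_delta i (fun k => qc x k)); apply: eq_bigr => k _.
  by rewrite polyt0 wE.
have Ps0 : Ps.[0] = Xs predT x.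
  by rewrite /Ps horner_sum; apply: eq_bigr => k _; exact: polys0.
(* At sigma = 0 all of e and t is concentrated at i, and the [amp] terms cancel. What remains is q_i
   times the sum of the other q_j^2, nonzero since n > 1. *)
have -> : G.[0] = qc x i * (Xs predT x - xs i x).
  have := polyt0 x w i; have := polye0 x w i; have := polys0 x i.
  rewrite wE eqxx /G /N /A; clear G N A.
  move: (polyt x w i) (polye x w i) (polys x i) Pe Pt Ps Pe0 Pt0 Ps0.
  move=> u v r Qe Qt Qs Qe0 Qt0 Qs0 r0 v0 u0.
  rewrite !(hornerD, hornerN, hornerM, hornerC, hornerX) Qe0 Qt0 Qs0 r0 v0 u0.
  by rewrite /amp /=; ring.
rewrite mulf_neq0 // /Xs (bigD1 i) //= addrAC subrr add0r.
have [j ji] : exists j : 'I_n, j != i.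
  have [i0|i0] := posnP i.
    by exists (Ordinal n1); rewrite -val_eqE /= i0.
  by exists (Ordinal (ltnW n1)); rewrite -val_eqE /= eq_sym -lt0n.
rewrite (bigD1 j) //= lt0r_neq0 // ltr_wpDr //.
  by apply: sumr_ge0 => k _; exact: sqr_ge0.
by rewrite exprn_even_gt0 //= xD.
Qed.

Lemma smooth_nondeg (k : 'I_n) :
  smooth PS (fun x => nondeg (xs^~ x) (xt^~ x) (xe b ^~ x) k).
Proof.
have oD := @open_phase_space R n.
have := @smooth_xs R n k; have := @smooth_xt R n k; have := @smooth_xe R n b k.
rewrite /nondeg; case: (k.+1 < n)%N => se st ss; last first.
  by apply: smoothB => //; apply: smoothM => //; [exact: smooth_Xt|exact: smooth_Xs].
have ss1 := @smooth_Xs R n (fun i => (i < k)%N).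
have ss2 := @smooth_Xs R n (fun i => (k < i)%N).
have st1 := @smooth_Xt R n (fun i => (i < k)%N).
have st2 := @smooth_Xt R n (fun i => (k < i)%N).
have se1 := @smooth_Xe R n b (fun i => (i < k)%N).
have se2 := @smooth_Xe R n b (fun i => (k < i)%N).
rewrite /det3; apply: smoothD => //; first apply: smoothB => //.
- by apply: smoothM => //; apply: smoothB => //; apply: smoothM.
- by apply: smoothM => //; apply: smoothB => //; apply: smoothM.
- by apply: smoothM => //; apply: smoothB => //; apply: smoothM.
Qed.

Lemma smooth_casimir_nondeg : smooth PS casimir_nondeg.
Proof.
by apply: smooth_prod => [|k _]; [exact: open_phase_space|exact: smooth_nondeg].
Qed.

Lemma smooth_hamI_nondeg i : smooth PS (hamI_nondeg i).
Proof.
have oD := @open_phase_space R n.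
have sN : smooth PS (fun x => Xe b predT x - kappa * omega2).
  by apply: smoothB => //; [exact: smooth_Xe|exact: smooth_cst].
have sA : smooth PS (amp kappa).
  by apply: smoothD => //; [exact: smooth_cst|exact: smooth_Xs].
apply: smoothB => //; apply: smoothM => //.
- exact: smooth_xt.
- by apply: smoothD => //; apply: smoothM => //; [exact: smooth_Xe|exact: smooth_Xs].
- exact: smooth_Xt.
- by apply: smoothD => //; apply: smoothM => //; [exact: smooth_xe|exact: smooth_xs].
Qed.

Lemma smooth_nonzero_near (f : phase -> R) x : smooth PS f -> PS x ->
  f x != 0 -> \forall y \near x, f y != 0.
Proof.
move=> sf xD fx0; have cf : f @ x --> f x := sf 0%N x xD.
have : nbhs (f x) [set c : R | c != 0].
  by apply: open_nbhs_nbhs; split => //; exact: open_neq.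
by move=> /cf.
Qed.

Definition regular_set (i : 'I_n) : set phase :=
  [set x | [/\ PS x, hamI_nondeg i x != 0 & casimir_nondeg x != 0]].

Lemma open_regular_set i : open (regular_set i).
Proof.
rewrite openE => x [xD hx cx]; rewrite /interior.
have hx' := smooth_nonzero_near (smooth_hamI_nondeg i) xD hx.
have cx' := smooth_nonzero_near smooth_casimir_nondeg xD cx.
have xD' : \forall y \near x, PS y.
  by apply: open_nbhs_nbhs; split => //; exact: open_phase_space.
by near=> y; split; near: y.
Unshelve. all: by end_near. Qed.

Lemma regular_set_dense i : (1 < n)%N -> PS `<=` closure (regular_set i).
Proof.
move=> n1 x xD O xO.
(* With the interior, O is also a neighbourhood of the intermediate point y, so the second condition
   can be reached from y without losing the first. *)
have xO' : nbhs x (O°) by exact: nbhs_interior.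
have [y [yO yD hy]] := hamI_nondeg_dense i n1 xD xO'.
have hy' := smooth_nonzero_near (smooth_hamI_nondeg i) yD hy.
have [z [[zO hz] zD cz]] := casimir_nondeg_dense yD (filterI yO hy').
by exists z.
Qed.

End Density.

(** * Functional independence *)

Section Independence.
Context {R : realType} {n : nat}.
Local Notation phase := (phase R n).
Variables (kappa omega2 : R) (b : 'I_n -> R).
Hypothesis kappa_gt0 : 0 < kappa.
Local Notation H := (ham kappa omega2 b).
Local Notation PS := (@phase_space R n).
Implicit Types (x v : phase) (i k : 'I_n).

Lemma dham_sl2const al ga x : phase_space x ->
  dham kappa omega2 b x (sl2vec b (fun=> al) (fun=> 0) (fun=> ga) x) =
  (ga * Xt predT x - al * (Xe b predT x + 2 * H x * Xs predT x)) / amp kappa x.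
Proof.
move=> xD; rewrite /dham; congr (_ / _).
rewrite (eq_bigr _ (fun k _ => dxe_sl2vec b _ _ _ k xD)).
rewrite (eq_bigr _ (fun k _ => dxs_sl2vec b _ _ _ x k)).
rewrite sumrB big_split /= -!big_distrr /=.
rewrite -/(Xs predT x) -/(Xe b predT x) -/(Xt predT x).
by field.
Qed.

Lemma hamI_coef0 i x a d : phase_space x ->
  hamI_nondeg kappa omega2 b i x != 0 ->
  (forall v, (forall P, dcas b x P v = 0) ->
     a * dham kappa omega2 b x v + d * dIint kappa omega2 b x i v = 0) ->
  a = 0 /\ d = 0.
Proof.
move=> xD nd rel.
have A0 := amp_neq0 kappa_gt0 x.
(* The two test vectors are q d/dp and q d/dq - p d/dp. *)
have h1 := rel _ (fun P => dcas_sl2vec b 0 0 1 P xD).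
have h3 := rel _ (fun P => dcas_sl2vec b 1 0 0 P xD).
move: h1 h3; rewrite /dIint !dham_sl2const // !dxe_sl2vec // !dxs_sl2vec.
move: nd; rewrite /hamI_nondeg hamE.
move: A0; move: (amp kappa x) (Xe b predT x) (Xs predT x) (Xt predT x) => A Je Js Jt.
move: (xs i x) (xt i x) (xe b i x) => s t e A0; set N := Je - _.
set h := N / (2 * A) => nd h1 h3.
have hN : N = 2 * h * A by rewrite /h; field.
(* With denominators cleared, [E1] and [E3] form a 2x2 system in a - 2 s d and d A, whose
   determinant is [hamI_nondeg] up to a nonzero factor. *)
have E1 : (a - 2 * s * d) * Jt + 2 * t * d * A = 0.
  by rewrite -[RHS](mulr0 A) -h1; field.
have E3 : (a - 2 * s * d) * (Je + 2 * h * Js) + (2 * e + 4 * h * s) * d * A = 0.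
  by rewrite -[RHS](mulr0 (- A)) -h3; field.
have d0 : d = 0.
  apply: (mulIf nd); rewrite mul0r hN.
  transitivity (((Je + 2 * h * Js) * ((a - 2 * s * d) * Jt + 2 * t * d * A)
    - Jt * ((a - 2 * s * d) * (Je + 2 * h * Js) + (2 * e + 4 * h * s) * d * A)) / 2).
    by field.
  by rewrite E1 E3; ring.
split=> //; apply: (mulIf nd); rewrite mul0r hN.
move: E1 E3; rewrite d0 !mulr0 !mul0r !addr0 !subr0 => E1 E3.
transitivity (t * A * (a * (Je + 2 * h * Js)) - A * (e + 2 * h * s) * (a * Jt)).
  ring.
by rewrite E1 E3; ring.
Qed.

(** Only the k-th pair is varied, so the partial sum moves only if it contains k, whence the factor
    [P k]. The rest pairs that sum, under the polarisation of Q, with a tangent vector of {Q = b_k}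
    at x_k. *)
Lemma dcas_single (al ga : R) P k x : phase_space x ->
  let d c := fun j : 'I_n => c * (j == k)%:R in
  dcas b x P (sl2vec b (d al) (fun=> 0) (d ga) x) =
  2 * (P k)%:R * (ga * (Xs P x * xt k x - Xt P x * xs k x)
                  + al * (Xe b P x * xs k x - Xs P x * xe b k x)).
Proof.
move=> xD d; rewrite /dcas.
have single f : \sum_(j | P j) f j * (j == k)%:R = (P k)%:R * f k :> R.
  rewrite big_mkcond -(sum_delta k (fun j => (P j)%:R * f j)) /=.
  by apply: eq_bigr => j _; case: (P j); rewrite ?mul1r ?mul0r.
have -> : \sum_(j | P j) dxe b x j (sl2vec b (d al) (fun=> 0) (d ga) x) =
    (P k)%:R * (2 * ga * xt k x - 2 * al * xe b k x).
  rewrite -(single (fun k => 2 * ga * xt k x - 2 * al * xe b k x)).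
  by apply: eq_bigr => j _; rewrite dxe_sl2vec // /d; ring.
have -> : \sum_(j | P j) dxs x j (sl2vec b (d al) (fun=> 0) (d ga) x) =
    (P k)%:R * (2 * al * xs k x).
  rewrite -(single (fun k => 2 * al * xs k x)).
  by apply: eq_bigr => j _; rewrite dxs_sl2vec /d; ring.
have -> : \sum_(j | P j) dxt x j (sl2vec b (d al) (fun=> 0) (d ga) x) =
    (P k)%:R * (ga * xs k x).
  rewrite -(single (fun k => ga * xs k x)).
  by apply: eq_bigr => j _; rewrite dxt_sl2vec // /d; ring.
ring.
Qed.

Lemma dcas_coef0 (beta gamma : nat -> R) x : (1 < n)%N -> phase_space x ->
  casimir_nondeg b x != 0 ->
  (forall v, \sum_(l <- index_iota 2 n)
       beta l * dcas b x (fun i => (i < l)%N) v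
     + \sum_(m <- index_iota 2 n.+1)
       gamma m * dcas b x (fun i => (n - m <= i)%N) v = 0) ->
  (forall l, (1 < l < n)%N -> beta l = 0) /\
  (forall m, (1 < m <= n)%N -> gamma m = 0).
Proof.
move=> n1 xD /prodf_neq0 nd rel.
have Zrel al ga k :
    ga * (Zsum beta gamma (xs^~ x) k * xt k x - Zsum beta gamma (xt^~ x) k * xs k x)
    + al * (Zsum beta gamma (xe b ^~ x) k * xs k x
            - Zsum beta gamma (xs^~ x) k * xe b k x) = 0.
  (* Bilinearity of the pairing collects the weighted values of [dcas_single] into a single pairing
     with [Zsum]. *)
  have lin (r : seq nat) (c : nat -> R) (p : nat -> bool) (f g h : nat -> R)
      (s t e : R) :
      ga * ((\sum_(l <- r) c l * ((p l)%:R * f l)) * t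
            - (\sum_(l <- r) c l * ((p l)%:R * g l)) * s)
      + al * ((\sum_(l <- r) c l * ((p l)%:R * h l)) * s
            - (\sum_(l <- r) c l * ((p l)%:R * f l)) * e)
      = 2^-1 * \sum_(l <- r) c l * (2 * (p l)%:R *
          (ga * (f l * t - g l * s) + al * (h l * s - f l * e))).
    rewrite !mulr_suml -!sumrB !mulr_sumr -big_split; apply: eq_bigr => l _ /=.
    by field.
  have := rel (sl2vec b (fun j => al * (j == k)%:R) (fun=> 0)
                        (fun j => ga * (j == k)%:R) x).
  under eq_bigr => l _ do rewrite dcas_single //.
  under [X in _ + X]eq_bigr => l _ do rewrite dcas_single //.
  move=> /(congr1 (fun c => 2^-1 * c)); rewrite mulr0 mulrDr -!lin => rel0.
  rewrite -[RHS]rel0 /Zsum -/(Xs _ _); ring.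
have s0 k : 0 < xs k x by rewrite exprn_even_gt0 //= xD.
(* The choices (al, ga) = (0, 1) and (-1, 0) give the two proportionalities that make Z_k a multiple
   of x_k. *)
apply: (casimir_coef0 n1 s0 nd) => k; apply/eqP; rewrite -subr_eq0; apply/eqP.
  by rewrite -[RHS](Zrel 0 1 k); ring.
by rewrite -[RHS](Zrel (-1) 0 k); ring.
Qed.

Lemma is_diff_differential (f df : phase -> R) x v : is_diff x f df ->
  differential f x v = df v.
Proof. by move=> [_ <-]; exact: lfunE. Qed.

Lemma free_differential i x : (1 < n)%N -> regular_set kappa omega2 b i x ->
  free [seq differential F x | F <- integrals kappa omega2 b i].
Proof.
move=> n1 [xD hnd cnd].
(* Labels are distinct by construction, whether or not the functions they name are known to
   differ. *)
pose F (u : bool + (nat + nat)) : phase -> R := match u with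
  | inl true => H
  | inl false => Iint kappa omega2 b i
  | inr (inl l) => Cup b l
  | inr (inr m) => Cdown b m
  end.
pose dF (u : bool + (nat + nat)) : phase -> R := match u with
  | inl true => dham kappa omega2 b x
  | inl false => dIint kappa omega2 b x i
  | inr (inl l) => dcas b x (fun i => (i < l)%N)
  | inr (inr m) => dcas b x (fun i => (n - m <= i)%N)
  end.
have FdF u : is_diff x (F u) (dF u).
  case: u => [[|]|[l|m]]; rewrite /F /dF.
  - exact: is_diff_ham.
  - exact: is_diff_Iint.
  - exact: is_diff_Cup.
  - exact: is_diff_Cdown.
pose idx : seq (bool + (nat + nat)) := inl true ::
  [seq inr (inl l) | l <- index_iota 2 n] ++
  [seq inr (inr m) | m <- index_iota 2 n.+1] ++ [:: inl false].
have -> : integrals kappa omega2 b i = [seq F u | u <- idx].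
  by rewrite /integrals /idx /= !map_cat -!map_comp.
rewrite -map_comp; apply: free_map.
  rewrite cons_uniq !cat_uniq !map_inj_uniq ?iota_uniq; [|by move=> ? ? [] ..].
  rewrite /= !mem_cat !orbF !andbT; apply/and3P; split.
  - by rewrite negb_or; apply/andP; split; apply/mapP => -[].
  - apply/hasPn => u; rewrite mem_cat inE => /orP[/mapP[m _ ->]|/eqP ->];
      by apply/mapP => -[].
  - by apply/mapP => -[].
move=> c rel.
pose beta l := c (inr (inl l)); pose gamma m := c (inr (inr m)).
have relv v : c (inl true) * dham kappa omega2 b x v
    + c (inl false) * dIint kappa omega2 b x i v
    + (\sum_(l <- index_iota 2 n) beta l * dcas b x (fun i => (i < l)%N) v
     + \sum_(m <- index_iota 2 n.+1)
       gamma m * dcas b x (fun i => (n - m <= i)%N) v) = 0.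
  transitivity (\sum_(u <- idx) c u * dF u v).
    rewrite /idx big_cons !big_cat /= !big_map big_seq1.
    by rewrite -addrA; congr (_ + _); rewrite addrC -addrA.
  transitivity ((\sum_(u <- idx) c u *: differential (F u) x) v).
    rewrite sum_lfunE; apply: eq_bigr => u _.
    by rewrite scale_lfunE (is_diff_differential v (FdF u)).
  by move: rel => /= ->; exact: zero_lfunE.
(* Tested on vectors killed by every dC, the relation involves only dH and dI_i; once their
   coefficients vanish, a relation between the dC is left. *)
have [a0 d0] : c (inl true) = 0 /\ c (inl false) = 0.
  apply: (hamI_coef0 xD hnd) => v dv0; rewrite -[RHS](relv v).
  by rewrite !big1 ?addr0 // => l _; rewrite dv0 mulr0.
have [beta0 gamma0] : (forall l, (1 < l < n)%N -> beta l = 0) /\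
    (forall m, (1 < m <= n)%N -> gamma m = 0).
  apply: (dcas_coef0 n1 xD cnd) => v; rewrite -[RHS](relv v).
  by rewrite a0 d0 !mul0r !add0r.
move=> u; rewrite inE mem_cat mem_cat inE => /or4P[/eqP ->|||/eqP ->] //.
  by move=> /mapP[l + ->]; rewrite mem_index_iota => /beta0.
by move=> /mapP[m + ->]; rewrite mem_index_iota => /gamma0.
Qed.

Lemma integralsP i (Q : (phase -> R) -> Prop) :
  Q H -> (forall m, Q (Cup b m)) -> (forall m, Q (Cdown b m)) ->
  Q (Iint kappa omega2 b i) ->
  forall F, F \in integrals kappa omega2 b i -> Q F.
Proof.
move=> QH Qup Qdown QI F; rewrite inE mem_cat mem_cat inE.
by move=> /or4P[/eqP ->|/mapP[l _ ->]|/mapP[m _ ->]|/eqP ->].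
Qed.

End Independence.

Theorem theorem2 (R : realType) (n : nat) (kappa omega2 : R) (b : 'I_n -> R)
    (hn : (2 <= n)%N) (hkappa : 0 < kappa) (homega2 : 0 <= omega2)
    (hb : forall j, 0 <= b j) :
  (forall i : 'I_n,
     [/\ first_integral (ham kappa omega2 b) (Iint kappa omega2 b i),
         size (integrals kappa omega2 b i) = (2 * n - 1)%N,
         forall F, F \in integrals kappa omega2 b i ->
           first_integral (ham kappa omega2 b) F
       & functionally_independent (integrals kappa omega2 b i)]) /\
  (forall (i j : 'I_n) (x : phase R n), phase_space x ->
     poisson (Iint kappa omega2 b i) (Iint kappa omega2 b j) x = 0).
Proof.
split=> [i|i j x xD]; last exact: poisson_Iint.
split.
- by move=> x; exact: poisson_Iint_ham.
- by rewrite /= !size_cat !size_map !size_iota /=; lia.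
- apply: integralsP => [|m|m|] x xD.
  + exact: poisson_ham_ham.
  + exact: poisson_Cup_ham.
  + exact: poisson_Cdown_ham.
  + exact: poisson_Iint_ham.
- split.
    apply: integralsP => [|m|m|].
    + exact: smooth_ham.
    + exact: smooth_Cup.
    + exact: smooth_Cdown.
    + exact: smooth_Iint.
  exists (regular_set kappa omega2 b i); split.
  + exact: open_regular_set.
  + by move=> x [].
  + exact: regular_set_dense.
  + by move=> x; exact: free_differential.
Qed.
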